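(* Let $\mathcal N$ be a nest on a complex Banach space $X$ with $\dim X\geq 2$. Then every invertible operator in $\mathrm{Alg}\,\mathcal N$ is an all-derivable point of $\mathrm{Alg}\,\mathcal N$.
   Context: $\mathcal B(X)$ denotes the algebra of all bounded linear operators on $X$. A nest $\mathcal N$ on $X$ is a chain (under inclusion) of norm-closed linear subspaces of $X$ containing $\{0\}$ and $X$, which is closed under the formation of arbitrary closed linear spans and arbitrary intersections; the trivial nest $\{\{0\},X\}$ is allowed. The associated nest algebra is $\mathrm{Alg}\,\mathcal N=\{T\in\mathcal B(X): TN\subseteq N \text{ for every } N\in\mathcal N\}$. For an algebra $\mathcal A$, a linear map $\delta:\mathcal A\to\mathcal A$ is a derivation if $\delta(AB)=\delta(A)B+A\delta(B)$ for all $A,B\in\mathcal A$. A map $\varphi:\mathcal A\to\mathcal A$ is derivable at a point $Z\in\mathcal A$ if $\varphi(A)B+A\varphi(B)=\varphi(Z)$ for all $A,B\in\mathcal A$ with $AB=Z$. An element $Z\in\mathcal A$ is an all-derivable point of $\mathcal A$ if every linear map $\mathcal A\to\mathcal A$ that is derivable at $Z$ is a derivation. Linear maps on $\mathrm{Alg}\,\mathcal N$ are not assumed continuous. *)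

(* Defs.v *)
From HB Require Import structures.
From mathcomp Require Import all_boot all_order all_algebra.
From mathcomp Require Import all_classical all_reals all_analysis.
From mathcomp Require Export complex.

Set Implicit Arguments.
Unset Strict Implicit.
Unset Printing Implicit Defensive.

Import Order.TTheory GRing.Theory Num.Theory.
Import numFieldNormedType.Exports.

Local Open Scope classical_set_scope.
Local Open Scope ring_scope.

Section BoundedOperators.
Variables (K : numFieldType) (X : normedModType K).

Definition bounded_op : {pred X -> X} := fun f =>
  `[< linear f /\ exists M : K, forall x, `|f x| <= M * `|x| >].

Lemma bounded_opP (f : X -> X) :
  reflect (linear f /\ exists M : K, forall x, `|f x| <= M * `|x|)
          (f \in bounded_op).
Proof. exact: asboolP. Qed.

Lemma bounded_op_submod : submod_closed bounded_op.
Proof.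
split.
  apply/bounded_opP; split; first by move=> a x y; rewrite /= scaler0 addr0.
  by exists 0 => x; rewrite normr0 mul0r.
move=> a f g /bounded_opP[fl [M fM]] /bounded_opP[gl [L gL]].
apply/bounded_opP; split.
  move=> b x y.
  rewrite -[LHS]/(a *: f (b *: x + y) + g (b *: x + y)).
  rewrite -[RHS]/(b *: (a *: f x + g x) + (a *: f y + g y)).
  rewrite fl gl !scalerDr !scalerA (mulrC a b) -!addrA; congr (_ + _).
  by rewrite addrCA.
exists (`|a| * M + L) => x; rewrite -[(a *: f + g) x]/(a *: f x + g x).
rewrite (le_trans (ler_normD _ _))// mulrDl lerD// normrZ -mulrA.
by rewrite ler_wpM2l.
Qed.

HB.instance Definition _ :=
  GRing.isSubmodClosed.Build K (X -> X) bounded_op bounded_op_submod.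

Record bop := Bop { bop_fun :> X -> X; bop_funP : bop_fun \in bounded_op }.

HB.instance Definition _ := [isSub for bop_fun].
HB.instance Definition _ := [Choice of bop by <:].
HB.instance Definition _ := [SubChoice_isSubLmodule of bop by <:].

Lemma bop_linear (T : bop) : linear T.
Proof. by have [] := bounded_opP _ (bop_funP T). Qed.

Lemma bop_ext (S T : bop) : S =1 T -> S = T.
Proof. by move=> ST; apply: val_inj; apply: funext. Qed.

Lemma bop_id_subproof : (fun x : X => x) \in bounded_op.
Proof.
by apply/bounded_opP; split => //; exists 1 => x; rewrite mul1r.
Qed.

Lemma bop_comp_subproof (S T : bop) : S \o T \in bounded_op.
Proof.
apply/bounded_opP; split.
  by move=> a x y; rewrite /= !bop_linear.
have [_ [M SM]] := bounded_opP _ (bop_funP S).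
have [_ [L TL]] := bounded_opP _ (bop_funP T).
exists (`|M| * L) => x /=.
have M0 : M * `|T x| <= `|M| * `|T x|.
  have [->|Tx0] := eqVneq (T x) 0; first by rewrite normr0 !mulr0.
  rewrite ler_wpM2r// real_ler_norm// ger0_real//.
  have := le_trans (normr_ge0 _) (SM (T x)).
  by rewrite pmulr_lge0// normr_gt0.
apply: le_trans (SM _) _; apply: le_trans M0 _.
by rewrite -mulrA ler_wpM2l.
Qed.

Definition bop_id := Bop bop_id_subproof.
Definition bop_comp (S T : bop) := Bop (bop_comp_subproof S T).

Lemma bop_addE (S T : bop) x : (S + T) x = S x + T x.
Proof. by []. Qed.

Lemma bop_scaleE a (T : bop) x : (a *: T) x = a *: T x.
Proof. by []. Qed.

Lemma bop_add_arg (T : bop) x y : T (x + y) = T x + T y.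
Proof. by have := bop_linear T 1 x y; rewrite !scale1r. Qed.

Lemma bop_compA : associative bop_comp.
Proof. by move=> S T U; apply: bop_ext. Qed.

Lemma bop_comp1l : left_id bop_id bop_comp.
Proof. by move=> T; apply: bop_ext. Qed.

Lemma bop_comp1r : right_id bop_id bop_comp.
Proof. by move=> T; apply: bop_ext. Qed.

Lemma bop_compDl : left_distributive bop_comp +%R.
Proof. by move=> S T U; apply: bop_ext. Qed.

Lemma bop_compDr : right_distributive bop_comp +%R.
Proof. by move=> S T U; apply: bop_ext => x; exact: bop_add_arg. Qed.

(* The library's algebra structures require 1 != 0, which fails for X = 0;
   hence the (possibly zero) ring structure next to the module structure. *)
HB.instance Definition _ := GRing.Zmodule_isPzRing.Build bop
  bop_compA bop_comp1l bop_comp1r bop_compDl bop_compDr.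

Lemma bop_mulE (S T : bop) x : (S * T) x = S (T x).
Proof. by []. Qed.

Lemma bop_oneE x : (1 : bop) x = x.
Proof. by []. Qed.

Definition invertible_op (T : bop) : Prop :=
  exists S : bop, S * T = 1 /\ T * S = 1.

End BoundedOperators.

Section Nests.
Variables (K : numFieldType) (X : normedModType K).

Definition dim_ge (n : nat) : Prop :=
  exists v : 'I_n -> X, forall c : 'I_n -> K,
    \sum_(i < n) c i *: v i = 0 -> forall i, c i = 0.

Definition linear_subspace (E : set X) : Prop :=
  E 0 /\ forall (a : K) (x y : X), E x -> E y -> E (a *: x + y).

Definition closed_span (E : set X) : set X :=
  closure (smallest linear_subspace E).

Record is_nest (N : set (set X)) : Prop := IsNest {
  nest_subspace : forall E, N E -> linear_subspace E;
  nest_closed : forall E, N E -> closed E;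
  nest_chain : forall E F, N E -> N F -> E `<=` F \/ F `<=` E;
  nest_zero : N [set 0];
  nest_full : N setT;
  nest_span : forall G : set (set X), G `<=` N ->
    N (closed_span (\bigcup_(E in G) E));
  nest_bigcap : forall G : set (set X), G `<=` N -> N (\bigcap_(E in G) E)
}.

Record nest := Nest { nest_set :> set (set X); nestP : is_nest nest_set }.

Variable N : nest.

Definition in_alg : {pred bop X} := fun T =>
  `[< forall E, nest_set N E -> T @` E `<=` E >].

Lemma in_algP (T : bop X) :
  reflect (forall E, nest_set N E -> T @` E `<=` E) (T \in in_alg).
Proof. exact: asboolP. Qed.

Lemma in_alg_submod : submod_closed in_alg.
Proof.
split.
  apply/in_algP => E NE _ [x _ <-].
  by have [] := nest_subspace (nestP N) NE.
move=> a S T /in_algP SN /in_algP TN; apply/in_algP => E NE _ [x Ex <-].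
have [_ Elin] := nest_subspace (nestP N) NE.
by apply: Elin; [apply: (SN _ NE)|apply: (TN _ NE)]; exists x.
Qed.

Lemma in_alg_subring : subring_closed in_alg.
Proof.
split.
- by apply/in_algP => E NE _ [x Ex <-].
- have [_ lin] := in_alg_submod => S T SN TN.
  by rewrite -[S - T]addrC -scaleN1r; apply: lin.
- move=> S T /in_algP SN /in_algP TN; apply/in_algP => E NE _ [x Ex <-].
  by apply: (SN _ NE); exists (T x) => //; apply: (TN _ NE); exists x.
Qed.

HB.instance Definition _ :=
  GRing.isSubmodClosed.Build K (bop X) in_alg in_alg_submod.
HB.instance Definition _ :=
  GRing.isSubringClosed.Build (bop X) in_alg in_alg_subring.

Record nest_alg := NestAlg {
  nest_alg_op :> bop X; nest_algP : nest_alg_op \in in_alg }.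

HB.instance Definition _ := [isSub for nest_alg_op].
HB.instance Definition _ := [Choice of nest_alg by <:].
HB.instance Definition _ := [SubChoice_isSubLmodule of nest_alg by <:].
HB.instance Definition _ := GRing.SubZmodule_isSubPzRing.Build (bop X) in_alg
  nest_alg in_alg_subring.

Definition derivation (delta : {linear nest_alg -> nest_alg}) : Prop :=
  forall A B : nest_alg, delta (A * B) = delta A * B + A * delta B.

Definition derivable_at (phi : nest_alg -> nest_alg) (Z : nest_alg) : Prop :=
  forall A B : nest_alg, A * B = Z -> phi A * B + A * phi B = phi Z.

Definition all_derivable_point (Z : nest_alg) : Prop :=
  forall phi : {linear nest_alg -> nest_alg},
    derivable_at phi Z -> derivation phi.

End Nests.

Arguments dim_ge {K} X n.

(* Main.v *)
From HB Require Import structures.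
Require Import Defs.
From mathcomp Require Import all_boot all_order all_algebra.
From mathcomp Require Import all_classical all_reals all_analysis.
From mathcomp Require Import ring lra.
From Stdlib Require Ncring Ncring_tac.

(* Applying derivability at [Z] to the pairs [(T, T^-1 Z)], with [T] equal to
   [A], [1 - A] and [A (1 - A)], and cancelling the surjective operator [Z],
   Hua's identity shows [phi (A ^ 2) = phi A A + A phi A] whenever [A] and
   [1 - A] are invertible in the nest algebra; by Neumann series and a scalar
   shift this holds for every [A], so [phi] is a Jordan derivation.

   Its defect [G (A, B) = phi (A B) - phi A B - A phi B] is a Hochschild
   cocycle, so [G = 0] as soon as [G (D, .) = 0] for the rank-one operators
   [D = x (x) f] of the nest algebra with [f] fixed and [x] in a total set.
   Let [M] be the closed span of the proper elements of the nest.
   - If [M = X], a triple factorization of [D] along a chain of the nest shows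
     that [G (A, D)] is a multiple of [D], and the cocycle identity forces this
     multiple to vanish.
   - If [X / M] is a line, [D] is a linear combination of idempotents [e] with
     [e A (1 - e) = 0] for all [A], and [G (e, .) = 0] for such [e].
   - Otherwise Herstein's identity
     [G (A, B) C [A, B] + [A, B] C G (A, B) = 0], for rank-one operators [C]
     vanishing on [M], first shows that [G (A, B)] maps [X] into [M], and then
     that [G (D, .) = 0]. *)

Set Implicit Arguments.
Unset Strict Implicit.
Unset Printing Implicit Defensive.

Import Order.TTheory GRing.Theory Num.Theory.
Import numFieldNormedType.Exports.

Local Open Scope classical_set_scope.
Local Open Scope ring_scope.

(** * Jordan derivations of noncommutative rings *)

(** These instances let the Stdlib tactic for noncommutative rings normalize identities in any
    [pzRingType]. *)
#[local] Instance pzring_ops (V : pzRingType) :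
  @Ncring.Ring_ops V 0 1 +%R *%R (fun x y => x - y) -%R eq := {}.

#[local] Instance pzring_ring (V : pzRingType) :
  Ncring.Ring (Ro := pzring_ops V).
Proof.
split; try exact: _.
- exact: add0r.
- exact: addrC.
- exact: addrA.
- exact: mul1r.
- exact: mulr1.
- exact: mulrA.
- exact: mulrDl.
- by move=> x y z; exact: mulrDr.
- exact: subrr.
Qed.

Ltac ncring := Ncring_tac.non_commutative_ring.

Section NoncommutativeRing.
Variable V : pzRingType.

(** Derives an equation from a known one [l = r], leaving a pure ring identity for [ncring]. *)
Lemma lincomb (l r p q : V) : l = r -> p + r = q + l -> p = q.
Proof. by move=> -> /addIr. Qed.

Lemma phi1_of_derivable (phi : V -> V) (Z : V) :
    (forall x, x * Z = 0 -> x = 0) ->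
    (forall x y, x * y = Z -> phi x * y + x * phi y = phi Z) ->
  phi 1 = 0.
Proof.
move=> Zreg /(_ 1 Z (mul1r Z)) e; apply: Zreg.
by apply: (lincomb e); rewrite mul1r; ncring.
Qed.

(* Hua's identity [a^-1 + (1 - a)^-1 = (a (1 - a))^-1], to which [phi] is
   applied after multiplication by [Z]. *)
Lemma jordan_of_derivable (phi : {additive V -> V}) (Z a a' b' : V) :
    (forall x, x * Z = 0 -> x = 0) ->
    (forall x y, x * y = Z -> phi x * y + x * phi y = phi Z) ->
    a * a' = 1 -> a' * a = 1 -> (1 - a) * b' = 1 -> b' * (1 - a) = 1 ->
  phi (a * a) = phi a * a + a * phi a.
Proof.
move=> Zreg der aa' a'a bb' b'b.
have phi1 := phi1_of_derivable Zreg der.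
(* Derivability at the pair [(t, t' * Z)], solved for [phi (t' * Z)]. *)
have phiV t t' : t * t' = 1 -> t' * t = 1 ->
    phi (t' * Z) = t' * phi Z - t' * phi t * t' * Z.
  move=> tt' t't; have := der t (t' * Z); rewrite mulrA tt' mul1r => /(_ erefl).
  move/(congr1 ( *%R t')); rewrite mulrDr !mulrA t't mul1r => e.
  by apply: (lincomb e); ncring.
set b := 1 - a in bb' b'b.
have phib : phi b = - phi a by rewrite raddfB /= phi1 sub0r.
have ab : a * b = b * a by rewrite /b; ncring.
have a'b' : a' * b' = a' + b'.
  have -> : a' * b' = a' * a * b' + a' * (b * b').
    by rewrite /b; ncring.
  by rewrite a'a bb' mul1r mulr1 addrC.
have := phiV (b * a) (a' * b').
rewrite !mulrA -(mulrA b a a') aa' mulr1 bb' => /(_ erefl).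
rewrite -(mulrA a' b' b) b'b mulr1 a'a => /(_ erefl).
rewrite {1}a'b' mulrDl raddfD /= (phiV a a')// (phiV b b')// phib => e.
have {}e : - (a' * phi a * a') + b' * phi a * b'
    + a' * b' * phi (b * a) * (a' * b') = 0.
  apply: Zreg; rewrite {1}a'b' in e.
  by apply: (lincomb e); ncring.
(* These outer factors clear every inverse and leave [- b * phi a * b + a * phi a * a + phi (b * a)
   = 0]. *)
have := congr1 (fun x => b * a * x * (a * b)) e.
rewrite mulr0 mul0r.
have -> : b * a * (- (a' * phi a * a') + b' * phi a * b' +
      a' * b' * phi (b * a) * (a' * b')) * (a * b) =
   - (b * (a * a') * phi a * (a' * a) * b)
   + a * (b * b') * phi a * (b' * (b * a))
   + b * (a * a') * b' * phi (b * a) * (a' * (b' * (b * a))).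
  by rewrite /b; ncring.
rewrite (mulrA b' b) b'b aa' bb' a'a !mulr1 !mul1r a'a mulr1 bb' mul1r.
have -> : b * a = a - a * a by rewrite /b; ncring.
rewrite raddfB /= /b => {}e.
by apply: (lincomb (esym e)); ncring.
Qed.

(** Here [phi t = 0], so the terms containing [t] agree on both sides: the Jordan identity is
    insensitive to scalar shifts. *)
Lemma jordan_shift (phi : {additive V -> V}) (t a : V) :
    (forall x, t * x = x * t) -> (forall x, phi (t * x) = t * phi x) ->
    phi 1 = 0 ->
    phi ((a + t) * (a + t)) = phi (a + t) * (a + t) + (a + t) * phi (a + t) ->
  phi (a * a) = phi a * a + a * phi a.
Proof.
move=> tC phit phi1.
have phit0 : phi t = 0 by rewrite -[t]mulr1 phit phi1 mulr0.
have -> : (a + t) * (a + t) = a * a + t * a + t * a + t * t.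
  by rewrite !mulrDl !mulrDr (tC a); ncring.
rewrite !raddfD /= !phit phit0 mulr0 !addr0 mulrDr mulrDl -(tC (phi a)) => e.
by apply: (lincomb e); ncring.
Qed.

Definition defect (phi : V -> V) (a b : V) : V :=
  phi (a * b) - phi a * b - a * phi b.

Variable phi : {additive V -> V}.
Local Notation G := (defect phi).

Lemma defectDl a b c : G (a + b) c = G a c + G b c.
Proof. by rewrite /defect mulrDl !raddfD /=; ncring. Qed.

Lemma defectDr a b c : G a (b + c) = G a b + G a c.
Proof. by rewrite /defect mulrDr !raddfD /=; ncring. Qed.

Lemma defectr0 a : G a 0 = 0.
Proof. by rewrite /defect !mulr0 raddf0 mulr0 !subr0. Qed.

Lemma defect_cocycle a b c :
  G a b * c = a * G b c - G (a * b) c + G a (b * c).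
Proof. by rewrite /defect mulrA; ncring. Qed.

Hypothesis two_torsion_free : forall a : V, a + a = 0 -> a = 0.
Hypothesis phiJ : forall a, phi (a * a) = phi a * a + a * phi a.

Let double_inj (a b : V) : a + a = b + b -> a = b.
Proof.
move=> ab; apply/subr0_eq/two_torsion_free.
by apply: (lincomb ab); ncring.
Qed.

(** Polarization: the Jordan identity at [a + b] minus those at [a] and [b]. *)
Lemma defect_anti a b : G a b = - G b a.
Proof.
have := phiJ (a + b); rewrite mulrDl !mulrDr !raddfD /= !phiJ => e.
by apply: (lincomb e); rewrite /defect; ncring.
Qed.

Lemma jordan2 a b :
  phi (a * b + b * a) = phi a * b + a * phi b + phi b * a + b * phi a.
Proof.
by rewrite raddfD /=; apply: (lincomb (defect_anti a b)); rewrite /defect;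
  ncring.
Qed.

(** Twice [a * b * a] is a combination of Jordan products, on which [phi] is known; then halve. *)
Lemma jordan3 a b :
  phi (a * b * a) = phi a * b * a + a * phi b * a + a * b * phi a.
Proof.
apply: double_inj; rewrite -raddfD.
have -> : a * b * a + a * b * a =
    a * (a * b + b * a) + (a * b + b * a) * a - ((a * a) * b + b * (a * a)).
  by ncring.
by rewrite raddfB /= !jordan2 !phiJ; ncring.
Qed.

Lemma jordan3l a b c : phi (a * b * c + c * b * a) =
  phi a * b * c + a * phi b * c + a * b * phi c +
  (phi c * b * a + c * phi b * a + c * b * phi a).
Proof.
have := jordan3 (a + c) b.
have -> : (a + c) * b * (a + c) =
    a * b * a + c * b * c + (a * b * c + c * b * a) by ncring.
rewrite !raddfD /= !jordan3 => e.
by apply: (lincomb e); ncring.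
Qed.

(* Expand [phi (a b c b a + b a c a b)] in two ways. *)
Lemma herstein_identity a b c :
  G a b * c * (a * b - b * a) + (a * b - b * a) * c * G a b = 0.
Proof.
have e1 := jordan3l (a * b) c (b * a).
have : phi (a * (b * c * b) * a + b * (a * c * a) * b) =
  phi (a * b * c * (b * a) + b * a * c * (a * b)).
  by congr (phi _); ncring.
rewrite e1 raddfD /= !jordan3 /= => e2.
have e : G a b * c * (b * a) + a * b * c * G b a
    + G b a * c * (a * b) + b * a * c * G a b = 0.
  by apply: (lincomb (esym e2)); rewrite /defect; ncring.
rewrite (defect_anti b a) in e.
by apply: (lincomb (esym e)); ncring.
Qed.

Lemma defect1l b : G 1 b = 0.
Proof.
have phi1 : phi 1 = 0.
  by apply: (lincomb (esym (phiJ 1))); rewrite mul1r; ncring.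
by rewrite /defect phi1 mul1r; ncring.
Qed.

(* Since [r q p = 0], the term [phi (p q r + r q p)] of the triple product
   formula is [phi (p q r)]; the other two hypotheses kill the cross terms. *)
Lemma phi_triple p q r :
  q * p = 0 -> r * phi q * p = 0 -> r * q = 0 ->
  phi (p * q * r) = phi p * q * r + p * phi q * r + p * q * phi r.
Proof.
move=> qp rqp rq; have := jordan3l p q r.
rewrite -(mulrA r q p) -(mulrA (phi r) q p) rqp rq qp !mulr0 mul0r !addr0.
exact.
Qed.

(* Left multiplication of [phi (e) = phi (e) e + e phi (e)] by [e] gives
   [e phi (e) = 0]. *)
Lemma defect_corner_idempotent e b :
  e * e = e -> (forall x, e * x = e * x * e) -> G e b = 0.
Proof.
move=> ee eV; have := phiJ e; rewrite ee => pe.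
have epe : e * phi e = 0.
  have := congr1 ( *%R e) pe; rewrite mulrDr !mulrA ee -eV => h.
  by apply: (lincomb (esym h)); ncring.
move: pe; rewrite epe addr0 => pe.
have ebp : e * b * phi e = 0 by rewrite eV -mulrA epe mulr0.
have pbe : phi e * b * e = phi e * b.
  by rewrite pe -2!(mulrA (phi e)) -eV.
have := jordan3 e b; rewrite -eV ebp addr0 pbe -(eV (phi b)) => h.
by apply: (lincomb h); rewrite /defect; ncring.
Qed.

(** [phi_triple] applies to [(p, q, r)], [(b * p, q, r)] and [(p, q, r * b)]; on subtraction only
    the defect at the outer factor survives. *)
Lemma defect_triple p q r :
    (forall b, q * b * p = 0) -> (forall b, r * b * p = 0) ->
    (forall b, r * b * q = 0) ->
  (forall b, G b (p * q * r) = G b p * q * r) /\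
  (forall b, G (p * q * r) b = p * q * G r b).
Proof.
move=> qp rp rq.
have qp1 : q * p = 0 by rewrite -[q]mulr1 qp.
have rq1 : r * q = 0 by rewrite -[r]mulr1 rq.
have phip := phi_triple qp1 (rp _) rq1.
split=> b; rewrite /defect phip.
  rewrite !mulrA (phi_triple (p := b * p)) ?mulrA ?qp// ?rq1//; last first.
    by rewrite -(mulrA r) rp.
  by ncring.
rewrite -(mulrA (p * q)) phi_triple ?qp1//.
- by ncring.
- by rewrite -!mulrA (mulrA b) mulrA rp.
Qed.

End NoncommutativeRing.

(** * Hahn-Banach separation over the complex numbers *)

Section HahnBanach.
Variables (R : realType) (V : lmodType R) (p : V -> R).
Hypothesis pD : forall x y, p (x + y) <= p x + p y.
Hypothesis pZ : forall (r : R) x, 0 <= r -> p (r *: x) = r * p x.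

(* Partial functionals are encoded by their graphs; domination by [p] makes a
   linear relation single-valued. *)
Record dominated (g : set (V * R)) : Prop := Dominated {
  dominated_lin : forall (r : R) x a y b,
    g (x, a) -> g (y, b) -> g (r *: x + y, r * a + b);
  dominated_le : forall x a, g (x, a) -> a <= p x
}.

Lemma dominated_extend g (x0 : V) : g (0, 0) -> dominated g ->
  exists2 h, dominated h & g `<=` h /\ exists a, h (x0, a).
Proof.
move=> g0 [glin gle].
(* Domination confines the new value at [x0] between the elements of [S] and the numbers
   [p (y + x0) - b]; the supremum of [S] is taken. *)
pose S := [set c | exists x a, g (x, a) /\ c = a - p (x - x0)].
have Sub x a y b : g (x, a) -> g (y, b) -> a - p (x - x0) <= p (y + x0) - b.
  move=> gx gy; have := gle _ _ (glin 1 _ _ _ _ gx gy).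
  rewrite scale1r mul1r => le1; have := pD (x - x0) (y + x0).
  rewrite addrACA addNr addr0 => le2; lra.
have supS : has_sup S.
  split; first by exists (0 - p (0 - x0)), 0, 0.
  by exists (p (0 + x0) - 0) => c [x [a [gx ->]]]; exact: Sub.
pose s := sup S.
have s_ge x a : g (x, a) -> a - p (x - x0) <= s.
  by move=> gx; apply: (sup_upper_bound supS); exists x, a.
have s_le y b : g (y, b) -> s <= p (y + x0) - b.
  move=> gy; apply: (ge_sup (proj1 supS)) => c [x [a [gx ->]]].
  exact: Sub.
have gZ r x a : g (x, a) -> g (r *: x, r * a).
  by move=> gx; have := glin r _ _ _ _ gx g0; rewrite !addr0.
exists [set q | exists x a r, g (x, a) /\ q = (x + r *: x0, a + r * s)].
  split=> [r _ _ _ _ [x [a [t [gx [-> ->]]]]] [y [b [u [gy [-> ->]]]]]|].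
    exists (r *: x + y), (r * a + b), (r * t + u); split; first exact: glin.
    by congr pair; [rewrite scalerDr scalerDl scalerA addrACA | ring].
  move=> _ _ [x [a [r [gx [-> ->]]]]].
  have [r0|r0|->] := ltgtP r 0; last first.
  - by rewrite scale0r mul0r !addr0; exact: gle.
  - have := s_le _ _ (gZ r^-1 _ _ gx).
    have -> : x + r *: x0 = r *: (r^-1 *: x + x0).
      by rewrite scalerDr scalerA mulfV ?gt_eqF// scale1r.
    rewrite (pZ _ (ltW r0)) -(ler_pM2l r0) mulrBr mulrA mulfV ?gt_eqF// mul1r.
    lra.
  - have nr0 : 0 < - r by rewrite oppr_gt0.
    have := s_ge _ _ (gZ (- r)^-1 _ _ gx).
    have -> : x + r *: x0 = (- r) *: ((- r)^-1 *: x - x0).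
      by rewrite scalerBr scalerA mulfV ?gt_eqF// scale1r scaleNr opprK.
    rewrite (pZ _ (ltW nr0)) -(ler_pM2l nr0) mulrBr mulrA mulfV ?gt_eqF// mul1r.
    lra.
split.
  by move=> [x a] gx; exists x, a, 0; rewrite scale0r mul0r !addr0.
by exists s, 0, 0, 1; rewrite !add0r scale1r mul1r.
Qed.

Theorem Hahn_Banach g : g (0, 0) -> dominated g ->
  exists u : V -> R, [/\ forall (r : R) x y, u (r *: x + y) = r * u x + u y,
    forall x, u x <= p x & forall x a, g (x, a) -> u x = a].
Proof.
move=> g0 dg.
have [F [Fdom gF] Fmax] : exists2 F, dominated F /\ g `<=` F &
    forall h, dominated h -> F `<=` h -> h = F.
  have [|F [[dF gF] Fmax]] :=
      @Zorn_bigcup _ [set h | dominated h /\ (h !=set0 -> g `<=` h)].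
    move=> F FP Ftot; split; last first.
      move=> [q [h Fh hq]] r gr; exists h => //.
      by apply: (FP h Fh).2 r gr; exists q.
    split=> [r x a y b [h Fh hx] [k Fk ky]|x a [h Fh hx]].
      have [hk|kh] := Ftot _ _ Fh Fk.
        by exists k => //; apply: (dominated_lin (FP k Fk).1) => //; exact: hk.
      by exists h => //; apply: (dominated_lin (FP h Fh).1) => //; exact: kh.
    exact: (dominated_le (FP h Fh).1).
  have Fn0 : F !=set0.
    apply/set0P/eqP => F0; apply: (Fmax g); last by split=> // _ q.
    by rewrite F0; split=> // g00; exact: (g00 _ g0).
  exists F; first by split=> //; exact: gF.
  move=> h dh Fh; apply/seteqP; split=> // q hq; apply: contrapT => Fq.
  apply: (Fmax h); first by split=> // hF; exact: Fq (hF _ hq).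
  by split=> // _; exact: subset_trans (gF Fn0) Fh.
have F0 := gF _ g0.
have [Flin Fle] := Fdom.
have tot x : exists a, F (x, a).
  have [h dh [Fh [a hxa]]] := dominated_extend x F0 Fdom.
  by exists a; rewrite -(Fmax _ dh Fh).
have single x a b : F (x, a) -> F (x, b) -> a = b.
  suff W c d : F (x, c) -> F (x, d) -> c <= d.
    by move=> Fa Fb; apply/eqP; rewrite eq_le !W.
  move=> Fc Fd; have := Fle _ _ (Flin (-1) _ _ _ _ Fd Fc).
  rewrite scaleN1r addNr mulN1r -(scale0r (0 : V)) pZ// mul0r; lra.
have [u Fu] := choice tot.
exists u; split=> [r x y|x|x a gx].
- by apply: single (Fu _) _; exact: Flin.
- exact: Fle.
- by apply: single (Fu x) _; exact: gF.
Qed.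
End HahnBanach.

Definition bounded_functional (K : numFieldType) (X : normedModType K)
    (f : X -> K) : Prop :=
  scalar f /\ exists M : K, forall x, `|f x| <= M * `|x|.

Section RealRestriction.
Local Open Scope complex_scope.
Variables (R : realType) (X : lmodType R[i]).

(** An alias of [X] that carries the real module structure, so that the real Hahn-Banach theorem
    applies. *)
Definition real_restriction : Type := X.

HB.instance Definition _ := GRing.Zmodule.on real_restriction.

Let scaleR (r : R) (x : real_restriction) : real_restriction :=
  r%:C *: (x : X).

Let scaleRA r s x : scaleR r (scaleR s x) = scaleR (r * s) x.
Proof. by rewrite /scaleR scalerA -rmorphM. Qed.

Let scale1R : left_id 1 scaleR.
Proof. by move=> x; rewrite /scaleR scale1r. Qed.

Let scaleRDr : right_distributive scaleR +%R.
Proof. by move=> r x y; rewrite /scaleR scalerDr. Qed.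

Let scaleRDl x : {morph scaleR^~ x : r s / r + s}.
Proof. by move=> r s; rewrite /scaleR rmorphD scalerDl. Qed.

HB.instance Definition _ := GRing.Zmodule_isLmodule.Build R real_restriction
  scaleRA scale1R scaleRDr scaleRDl.

Lemma real_restrictionE (r : R) (x : real_restriction) :
  r *: x = r%:C *: (x : X).
Proof. by []. Qed.

End RealRestriction.

Section Separation.
Local Open Scope complex_scope.
Variables (R : realType) (X : normedModType R[i]).

(** The norm takes values in [R[i]]; this is the same number as a real, for use as the sublinear
    bound. *)
Let reN (x : X) : R := complex.Re `|x|.

Let normE (x : X) : `|x| = (reN x)%:C.
Proof. by rewrite RRe_real// normr_real. Qed.

Let reN_ge0 x : 0 <= reN x.
Proof. by have := normr_ge0 x; rewrite normE ler0c. Qed.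

Let reND x y : reN (x + y) <= reN x + reN y.
Proof. by have := ler_normD x y; rewrite !normE -rmorphD lecR. Qed.

Let reNZ (r : R) (x : X) : 0 <= r -> reN (r%:C *: x) = r * reN x.
Proof.
move=> r0; have := normrZ r%:C x.
by rewrite (ger0_norm (_ : 0 <= r%:C)) ?ler0c// !normE -rmorphM => -[].
Qed.

Let scaleC (a b : R) (x : X) :
  (a +i* b) *: x = a%:C *: x + b%:C *: ('i *: x).
Proof. by rewrite scalerA -scalerDl; congr (_ *: _); simpc. Qed.

(* [f = u - i u(i .)] recovers a complex functional from its real part. *)
Let complexify (u : real_restriction X -> R) (x : X) : R[i] :=
  u x -i* u ('i *: x).

Let complexifyP u : (forall r x y, u (r *: x + y) = r * u x + u y) ->
  scalar (complexify u).
Proof.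
move=> ul.
have u0 : u 0 = 0.
  have /eqP := ul 1 0 0.
  by rewrite scale1r mul1r !addr0 eq_sym -subr_eq0 addrK => /eqP.
have uZ r (x : X) : u (r%:C *: x) = r * u x.
  by have := ul r x 0; rewrite !addr0 u0 addr0.
have uD (x y : X) : u (x + y) = u x + u y.
  by have := ul 1 x y; rewrite scale1r mul1r.
move=> [a b] x y; rewrite /complexify.
have -> : 'i *: ((a +i* b) *: x + y) =
    (a +i* b) *: ('i *: x) + 'i *: y :> X.
  by rewrite scalerDr !scalerA mulrC.
have uN x' : u (- x' : X) = - u x'.
  by rewrite -scaleN1r -(rmorphN1 (real_complex R)) uZ mulN1r.
rewrite !uD !(scaleC a b) !uD !uZ scalerA -expr2 sqr_i scaleN1r uN.
by apply/eqP; rewrite eq_complex /=; apply/andP; split; apply/eqP; ring.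
Qed.

Theorem closed_subspace_separation (E : set X) (z : X) :
  closed E -> linear_subspace E -> ~ E z ->
  exists f : X -> R[i],
    [/\ bounded_functional f, forall y, E y -> f y = 0 & f z = 1].
Proof.
move=> Ecl [E0 Elin] Ez.
(* [d] is the radius of a ball around [z] that misses [E]. The functional to extend sends [y + r z]
   to [r d] for [y] in [E] and real [r]. *)
have [d d0 dE] : exists2 d : R, 0 < d & forall y, E y -> d <= reN (z - y).
  have : nbhs z (~` E).
    by apply: open_nbhs_nbhs; split=> //; exact: closed_openC.
  rewrite -nbhs_ballE => -[e /= e0 eE]; exists (complex.Re e).
    by move: e0; rewrite ltcE => /andP[].
  move=> y Ey; rewrite leNgt; apply/negP => lt; apply: (eE y) => //.
  rewrite -ball_normE /= normE -(RRe_real (gtr0_real e0)) ltcR//.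
pose g := [set q : real_restriction X * R |
  exists y r, E y /\ q = (y + r%:C *: z, r * d)].
have Ez' y (a : R[i]) : E y -> E (a *: y).
  by move=> Ey; have := Elin a y 0 Ey E0; rewrite addr0.
have g0 y : E y -> g (y, 0).
  by move=> Ey; exists y, 0; rewrite scale0r addr0 mul0r.
have dg : @dominated R (real_restriction X) reN g.
  split=> [r _ _ _ _ [x [a [Ex [-> ->]]]] [y [b [Ey [-> ->]]]]|].
    exists (r%:C *: x + y), (r * a + b); split; first exact: Elin.
    congr pair; last by ring.
    rewrite real_restrictionE scalerDr rmorphD rmorphM scalerDl -scalerA.
    exact: addrACA.
  move=> _ _ [y [r [Ey [-> ->]]]].
  have [r0|r0] := leP r 0.
    apply: (@le_trans _ _ 0); last exact: reN_ge0.
    by rewrite pmulr_lle0.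
  have -> : y + r%:C *: z = r%:C *: (z - (- r^-1%:C) *: y).
    rewrite scaleNr opprK scalerDr scalerA -rmorphM mulfV ?gt_eqF//.
    by rewrite scale1r addrC.
  by rewrite (reNZ _ (ltW r0)) ler_pM2l//; apply/dE/Ez'.
have [|||u [ul up ug]] := @Hahn_Banach R (real_restriction X) reN _ _ g _ dg.
- exact: reND.
- by move=> r x r0; exact: reNZ.
- exact: g0.
have ug0 : u 0 = 0 by apply: ug; exact: g0.
have fl := complexifyP ul; set f := complexify u in fl.
have fz : f z != 0.
  apply/eqP => -[uz _]; move: d0.
  suff : u z = 1 * d by rewrite uz mul1r => <-; rewrite ltxx.
  by apply: ug; exists 0, 1; rewrite scale1r add0r.
exists (fun x => (f z)^-1 * f x); split; last by rewrite mulVf.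
  split; first by move=> a x y; rewrite fl mulrDr mulrCA.
  (* Real and imaginary parts of [f x] are each bounded by the norm of [x], hence the factor 2. *)
  exists (`|f z|^-1 * (1 + 1)) => x.
  rewrite normrM normfV -mulrA ler_wpM2l// ?invr_ge0//.
  have u_le (w : X) : `|u w| <= reN w.
    rewrite ler_norml up andbT lerNl.
    have := ul (-1) w 0; rewrite scaleN1r addr0 ug0 addr0 mulN1r => <-.
    by apply: le_trans (up _) _; rewrite /reN normrN.
  have reNi : reN ('i *: x) = reN x by rewrite /reN normrZ normCi mul1r.
  have ux := u_le x; have := u_le ('i *: x); rewrite reNi => uix.
  rewrite normc_def normE mulrDl mul1r -rmorphD lecR /=.
  rewrite -[leRHS]ger0_norm ?addr_ge0 ?reN_ge0// -sqrtr_sqr ler_wsqrtr//.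
  move: ux uix; rewrite !ler_norml => /andP[? ?] /andP[? ?]; nra.
(* Both [y] and ['i *: y] lie in [E], so both parts of [f y] vanish. *)
move=> y Ey; rewrite /f /complexify.
by rewrite (ug _ _ (g0 _ Ey)) (ug _ _ (g0 _ (Ez' _ _ Ey))) oppr0 mulr0.
Qed.
End Separation.

(** * Inverses in nest algebras *)

Section NestAlgTheory.
Variables (K : numFieldType) (X : normedModType K) (N : nest X).
Implicit Types A B : nest_alg N.

Lemma nest_alg_ext A B : (forall x, A x = B x) -> A = B.
Proof. by move=> AB; apply: val_inj; apply: bop_ext. Qed.

Lemma nest_algD A B x : (A + B) x = A x + B x. Proof. by []. Qed.
Lemma nest_algN A x : (- A) x = - A x. Proof. by []. Qed.
Lemma nest_algB A B x : (A - B) x = A x - B x. Proof. by []. Qed.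
Lemma nest_algM A B x : (A * B) x = A (B x). Proof. by []. Qed.
Lemma nest_algZ k A x : (k *: A) x = k *: A x. Proof. by []. Qed.
Lemma nest_alg1 x : (1 : nest_alg N) x = x. Proof. by []. Qed.
Lemma nest_alg0 x : (0 : nest_alg N) x = 0. Proof. by []. Qed.

Lemma nest_alg_argD A x y : A (x + y) = A x + A y.
Proof. exact: bop_add_arg. Qed.
Lemma nest_alg_arg0 A : A 0 = 0.
Proof.
by have := bop_linear A (-1) 0 0; rewrite scaler0 addr0 scaleN1r addNr.
Qed.

Lemma nest_alg_argZ A k x : A (k *: x) = k *: A x.
Proof. by have := bop_linear A k x 0; rewrite !addr0 nest_alg_arg0 addr0. Qed.
Lemma nest_alg_argN A x : A (- x) = - A x.
Proof. by rewrite -scaleN1r nest_alg_argZ scaleN1r. Qed.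
Lemma nest_alg_stable A E x : nest_set N E -> E x -> E (A x).
Proof. by move=> NE Ex; apply: (in_algP N A (nest_algP A) E NE); exists x. Qed.

End NestAlgTheory.

(** * Neumann series inside the nest algebra *)

Section Neumann.
Variables (R : realType) (X : completeNormedModType R[i]%C).

(** The iterates of [z |-> x + S z] from 0 are the partial sums of the Neumann series. They stay in
    each closed invariant subspace containing [x], and so does their limit; this keeps the inverse
    in the nest algebra. *)
Lemma neumann_solution (S : bop X) (x : X) :
    (forall y, `|S y| <= 2^-1 * `|y|) ->
  exists2 y, y = x + S y & forall E : set X, closed E -> linear_subspace E ->
    S @` E `<=` E -> E x -> E y.
Proof.
move=> hS.
pose y n := iter n (fun z => x + S z) 0.
have SB a b : S a - S b = S (a - b).
  by rewrite [a - b]addrC -[- b]scaleN1r bop_linear scaleN1r addrC.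
have y_le k : `|y k| <= 2 * `|x|.
  elim: k => [|k IH]; first by rewrite normr0 mulr_ge0.
  rewrite /= (le_trans (ler_normD _ _))// mulrDl mul1r lerD//.
  rewrite (le_trans (hS _))// ler_pdivrMl//.
have y_dist n k : `|y (n + k)%N - y n| <= 2^-1 ^+ n * (2 * `|x|).
  elim: n => [|n IH]; first by rewrite subr0 mul1r.
  rewrite addSn /= opprD addrACA subrr add0r SB (le_trans (hS _))//.
  by rewrite exprS -mulrA ler_wpM2l// invr_ge0.
have ycvg : cvgn y.
  apply/cauchy_cvgP/cauchy_exP => e e0.
  have [n hn] : exists n, 2^-1 ^+ n * (2 * `|x|) < e.
    have : 0 <= 2 * `|x| by rewrite mulr_ge0.
    (* Nonnegative complex numbers have zero imaginary part, so the claim becomes a real one,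
       settled by [n < 2 ^ n]. *)
    move: (2 * `|x|) e0 => [c c'] e0 /[dup] /ger0_Im /= -> .
    move: e e0 => [e e'] /[dup] /ltW /ger0_Im /= ->.
    rewrite ltcR ler0c => e0 c0; exists (Num.truncn (c / e)).+1.
    rewrite -(rmorph_nat (real_complex R)) -fmorphV -rmorphXn -rmorphM ltcR.
    rewrite exprVn ltr_pdivrMl ?exprn_gt0// -ltr_pdivrMr//.
    apply: lt_trans (truncnS_gt _) _.
    by rewrite -natrX ltr_nat ltn_expl.
  exists (y n); exists n => // m /= nm.
  rewrite -ball_normE /= distrC -(subnKC nm).
  exact: le_lt_trans (y_dist _ _) hn.
pose l := limn y; exists l.
  have Scvg : S (y n) @[n --> \oo] --> S l.
    apply/cvgrPdist_lt => e e0.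
    have /cvgrPdist_lt /(_ e e0) := ycvg.
    apply: filterS => n; rewrite SB; apply: le_lt_trans.
    by rewrite (le_trans (hS _))// ler_piMl// invf_le1// ler1n.
  have : y n.+1 @[n --> \oo] --> x + S l by apply: cvgD => //; exact: cvg_cst.
  have /cvg_unique : y n.+1 @[n --> \oo] --> l by rewrite cvg_shiftS.
  by apply; exact: norm_hausdorff.
move=> E Ecl [E0 Elin] SE Ex; apply: (closed_cvg E Ecl) ycvg.
apply: nearW; elim=> [//|n IH] /=.
rewrite -[x]scale1r; apply: Elin => //; apply: SE; by exists (y n).
Qed.

Variable N : nest X.
Implicit Types A S : nest_alg N.

(** Solutions of [y = x + S y] are unique because [S] is a contraction; uniqueness makes the
    solution operator linear and a two-sided inverse. *)
Lemma neumann_inverse S : (forall y, `|S y| <= 2^-1 * `|y|) ->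
  exists V : nest_alg N, (1 - S) * V = 1 /\ V * (1 - S) = 1.
Proof.
move=> hS.
have inj x : x = S x -> x = 0.
  move=> xS; apply/eqP; rewrite -normr_eq0 eq_le normr_ge0 andbT.
  have := hS x; rewrite -xS -subr_ge0 -{2}[`|x|]mul1r -mulrBl.
  by rewrite nmulr_rge0// subr_lt0 invf_lt1// ltr1n.
have /choice [V hV] x :
    exists y, y = x + S y /\ forall E, nest_set N E -> E x -> E y.
  have [y yS yE] := neumann_solution x hS; exists y; split=> // E NE.
  apply: yE; first exact: nest_closed (nestP N) _ NE.
    exact: nest_subspace (nestP N) _ NE.
  by move=> _ [z Ez <-]; exact: nest_alg_stable.
have VS x y : y = x + S y -> V x = y.
  have [Vx _] := hV x => yx; apply/subr0_eq/inj.
  by rewrite nest_alg_argD nest_alg_argN {1}Vx {1}yx opprD addrACA subrr add0r.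
have Vlin : linear V.
  move=> a x y; apply: VS; have [Vx _] := hV x; have [Vy _] := hV y.
  by rewrite {1}Vx {1}Vy nest_alg_argD nest_alg_argZ scalerDr addrACA.
have VP : V \in bounded_op (X := X).
  apply/bounded_opP; split=> //; exists 2 => x; have [Vx _] := hV x.
  have h : `|V x| <= `|x| + 2^-1 * `|V x|.
    by rewrite {1}Vx (le_trans (ler_normD _ _))// lerD2l.
  rewrite -ler_pdivrMl//; move: h; rewrite -lerBlDr -{1}[`|V x|]mul1r -mulrBl.
  by congr (_ * _ <= _); field.
have VN : Bop VP \in Defs.in_alg N.
  apply/in_algP => E NE _ [x Ex <-] /=; have [_] := hV x; exact.
exists (NestAlg VN); split; apply: nest_alg_ext => x.
  by rewrite nest_algM nest_algB nest_alg1 /= {1}(hV x).1 addrK.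
rewrite nest_algM nest_algB nest_alg1 /=; apply: VS.
by rewrite subrK.
Qed.

(** Factor [A + t] as [t (1 + t^-1 A)]: for [t] of modulus at least twice a bound of [A], the
    perturbation is at most one half. *)
Lemma add_scalar_invertible A : exists2 M : R[i]%C, 0 <= M &
  forall t : R[i]%C, M <= `|t| -> t != 0 ->
  exists V : nest_alg N, (A + t *: (1 : nest_alg N)) * V = 1 /\
    V * (A + t *: (1 : nest_alg N)) = 1.
Proof.
have [_ [M AM]] := bounded_opP _ (bop_funP A).
exists (2 * `|M|); first by rewrite mulr_ge0.
move=> t Mt t0.
have [|V [VA AV]] := @neumann_inverse (- (t^-1 *: A)).
  move=> y.
  rewrite nest_algN nest_algZ normrN normrZ normfV.
  rewrite ler_pdivrMl ?normr_gt0// (le_trans (AM y))//.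
  rewrite -(ger0_norm (le_trans (normr_ge0 _) (AM y))) normrM normr_id mulrA.
  by rewrite ler_wpM2r// ler_pdivlMr// mulrC.
have tA : A + t *: (1 : nest_alg N) = t *: (1 - - (t^-1 *: A)).
  by rewrite opprK addrC scalerDr scalerA mulfV// scale1r.
exists (t^-1 *: V); split; apply: nest_alg_ext => x; rewrite tA.
  have := congr1 (fun B : nest_alg N => B x) VA.
  by rewrite !nest_algM !nest_algZ nest_alg_argZ scalerA mulfV// scale1r.
have := congr1 (fun B : nest_alg N => B x) AV.
by rewrite !nest_algM !nest_algZ nest_alg_argZ scalerA mulVf// scale1r.
Qed.
End Neumann.

(** * Rank-one operators in nest algebras *)

Section Functionals.
Variables (K : numFieldType) (X Y : normedModType K).

Lemma closed_kernel (h : X -> Y) (M : K) :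
    (forall x y, h (x - y) = h x - h y) -> (forall x, `|h x| <= M * `|x|) ->
  closed [set x | h x = 0].
Proof.
move=> hB hM; rewrite -openC openE => x /= /eqP hx.
(* Adding 1 keeps the denominator of the radius positive even if [M] is 0. *)
have M0 : 0 < `|M| + 1 by rewrite ltr_wpDl.
apply/nbhs_ballP; exists (`|h x| / (`|M| + 1)) => /=.
  by rewrite divr_gt0 ?normr_gt0.
move=> y; rewrite -ball_normE /= ltr_pdivlMr// mulrC => lt hy.
have := hM (x - y); rewrite hB hy subr0 => le.
have : M * `|x - y| <= (`|M| + 1) * `|x - y|.
  rewrite -(ger0_norm (le_trans (normr_ge0 _) le)) normrM normr_id.
  by rewrite ler_wpM2r// lerDl.
by move=> /(le_trans le)/le_lt_trans/(_ lt); rewrite ltxx.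
Qed.

Variable f : X -> K.
Hypothesis fb : bounded_functional f.

Lemma functionalD x y : f (x + y) = f x + f y.
Proof. by have := fb.1 1 x y; rewrite scale1r mul1r. Qed.

Lemma functional0 : f 0 = 0.
Proof. by have := fb.1 (-1) 0 0; rewrite scaler0 addr0 mulN1r addNr. Qed.

Lemma functionalZ k x : f (k *: x) = k * f x.
Proof. by have := fb.1 k x 0; rewrite !addr0 functional0 addr0. Qed.

Lemma functionalB x y : f (x - y) = f x - f y.
Proof. by rewrite functionalD -scaleN1r functionalZ mulN1r. Qed.

End Functionals.

Lemma closed_functional_kernel (K : numFieldType) (X : normedModType K)
    (f : X -> K) : bounded_functional f -> closed [set x | f x = 0].
Proof.
move=> fb; have [_ [M fM]] := fb.
exact: (@closed_kernel _ X K f M (functionalB fb) fM).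
Qed.

Section RankOne.
Variables (K : numFieldType) (X : normedModType K) (N : nest X).
Implicit Types (A B D : nest_alg N) (f : X -> K).

Lemma bounded_functional_comp f A :
  bounded_functional f -> bounded_functional (f \o A).
Proof.
move=> [fl [M fM]]; have [_ [L AL]] := bounded_opP _ (bop_funP A).
split; first by move=> a x y; rewrite /= bop_linear fl.
exists (`|M| * L) => x /=; apply: le_trans (fM _) _.
rewrite -(ger0_norm (le_trans (normr_ge0 _) (fM _))) normrM normr_id -mulrA.
by rewrite ler_wpM2l.
Qed.

Lemma bounded_functional_add f g : bounded_functional f ->
  bounded_functional g -> bounded_functional (fun x => f x + g x).
Proof.
move=> [fl [M fM]] [gl [L gL]]; split.
  by move=> a x y; rewrite fl gl mulrDr addrACA.
by exists (M + L) => x; rewrite mulrDl (le_trans (ler_normD _ _))// lerD.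
Qed.

Definition rank_one D (x : X) f : Prop := forall y, D y = f y *: x.

Lemma rank_one_exists x f : bounded_functional f ->
    (forall E, nest_set N E -> E x \/ forall y, E y -> f y = 0) ->
  exists D, rank_one D x f.
Proof.
move=> [fl [M fM]] fE.
have DP : (fun y => f y *: x) \in bounded_op (X := X).
  apply/bounded_opP; split.
    by move=> a y z; rewrite fl scalerDl -scalerA.
  by exists (M * `|x|) => y; rewrite normrZ mulrAC ler_wpM2r.
have DN : Bop DP \in Defs.in_alg N.
  apply/in_algP => E NE _ [y Ey <-] /=.
  have [E0 Elin] := nest_subspace (nestP N) NE.
  have [Ex|fE0] := fE E NE; last by rewrite fE0// scale0r.
  by rewrite -[_ *: _]addr0; exact: Elin.
by exists (NestAlg DN).
Qed.

Lemma rank_one_mull A D x f : rank_one D x f -> rank_one (A * D) (A x) f.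
Proof. by move=> Dxf y; rewrite nest_algM Dxf nest_alg_argZ. Qed.

Lemma rank_one_mulr A D x f : rank_one D x f -> rank_one (D * A) x (f \o A).
Proof. by move=> Dxf y; rewrite nest_algM Dxf. Qed.

Lemma rank_one_add D D' x f f' : rank_one D x f -> rank_one D' x f' ->
  rank_one (D + D') x (fun y => f y + f' y).
Proof. by move=> Dxf Dxf' y; rewrite nest_algD Dxf Dxf' scalerDl. Qed.

Lemma rank_one_uniq D D' x f : rank_one D x f -> rank_one D' x f -> D = D'.
Proof. by move=> Df D'f; apply: nest_alg_ext => y; rewrite Df D'f. Qed.

Lemma nest_alg_scalerAl k A B : k *: A * B = k *: (A * B).
Proof. exact: nest_alg_ext. Qed.

Lemma nest_alg_scalerAr k A B : A * (k *: B) = k *: (A * B).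
Proof.
by apply: nest_alg_ext => x; rewrite nest_algM !nest_algZ nest_alg_argZ.
Qed.

Lemma nest_alg_two_torsion_free A : A + A = 0 -> A = 0.
Proof.
move=> AA; have : (2 : K) *: A = 0 by rewrite scaler_nat mulr2n.
by move/eqP; rewrite scaler_eq0 pnatr_eq0 => /eqP.
Qed.

Lemma nest_alg_kernel A :
  closed [set x | A x = 0] /\ linear_subspace [set x | A x = 0].
Proof.
split.
  have [_ [M AM]] := bounded_opP _ (bop_funP A).
  apply: (@closed_kernel _ X X A M) => // x y.
  by rewrite nest_alg_argD nest_alg_argN.
split=> [|a x y /= Ax Ay]; first exact: nest_alg_arg0.
by rewrite nest_alg_argD nest_alg_argZ Ax Ay scaler0 addr0.
Qed.

End RankOne.

(** * Criteria for the vanishing of the defect *)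

Section JordanDefect.
Variables (K : numFieldType) (X : normedModType K) (N : nest X).
Implicit Types (A B D : nest_alg N) (f : X -> K).
Variable phi : {linear nest_alg N -> nest_alg N}.
Hypothesis phiJ : forall A, phi (A * A) = phi A * A + A * phi A.
Local Notation G := (defect phi).

Let anti := defect_anti phiJ.

(** [B * D] is again rank one, with the same [f] and the vector [B x]. Hence the cocycle identity
    for [(A, B, D)] gives [G A B * D = 0], to be evaluated where [f] does not vanish. *)
Lemma defect_annihilates (S : set X) f :
    (forall B x, S x -> S (B x)) -> (exists y, f y <> 0) ->
    (forall x, S x -> exists2 D, rank_one D x f & forall B, G D B = 0) ->
  forall A B x, S x -> G A B x = 0.
Proof.
move=> SB [y /eqP fy] SD A B x Sx.
have [D Dx DG] := SD x Sx; have [D' D'x D'G] := SD _ (SB B x Sx).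
have := defect_cocycle phi A B D.
rewrite (rank_one_uniq (rank_one_mull B Dx) D'x).
rewrite (anti _ D) (anti _ D) (anti _ D') !DG D'G oppr0 mulr0 subr0 addr0.
move/(congr1 (fun C : nest_alg N => C y)).
rewrite nest_algM Dx nest_alg_argZ nest_alg0 => /eqP.
by rewrite scaler_eq0 (negbTE fy) => /eqP.
Qed.

(* [G (A, D)] and [G (A, D A)] have the same multiplier [c], so the cocycle
   identity for [(D, A, A)] makes [2 c D A] a multiple of [D]. *)
Lemma scalar_defect_eq0 (DD : set (nest_alg N)) :
    (forall D D', DD D -> DD D' -> DD (D + D')) ->
    (forall D A, DD D -> DD (D * A)) ->
    (forall D A, DD D -> exists c, G A D = c *: D) ->
  forall D B, DD D -> (forall k, D * B <> k *: D) -> forall A, G A D = 0.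
Proof.
move=> DDD DDM DDc D B DDD0 DB.
have W A : (forall k, D * A <> k *: D) -> G A D = 0.
  move=> DA; have [c cE] := DDc D A DDD0.
  have [c' c'E] := DDc _ A (DDM D A DDD0).
  have [c'' c''E] := DDc _ A (DDD _ _ DDD0 (DDM D A DDD0)).
  have [d dE] := DDc D (A * A) DDD0.
  have D0 : D != 0.
    by apply/eqP => D0; apply: (DA 0); rewrite D0 mul0r scaler0.
  have ind a b : a *: (D * A) = b *: D -> a = 0.
    move=> ab; apply/eqP/negPn/negP => a0; apply: (DA (a^-1 * b)).
    by rewrite -scalerA -ab scalerA mulVf// scale1r.
  (* Comparing coefficients of the independent [D] and [D * A] in [G A (D + D * A)] equates the
     three multipliers. *)
  have := c''E; rewrite defectDr cE c'E scalerDr => e.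
  have c'c : c' - c'' = 0.
    apply: (ind _ (c'' - c)); rewrite !scalerBl.
    by apply: (lincomb e); ncring.
  move: e; rewrite (subr0_eq c'c) => /addIr/eqP.
  rewrite -subr_eq0 -scalerBl scaler_eq0 (negbTE D0) orbF subr_eq0 => /eqP cc.
  have := defect_cocycle phi D A A.
  have -> : G A A = 0 by rewrite /defect phiJ; ncring.
  rewrite (anti D A) (anti (D * A) A) (anti D (A * A)) cE c'E dE.
  rewrite mulr0 sub0r opprK (subr0_eq c'c) -cc mulNr nest_alg_scalerAl => e.
  have : (c + c) *: (D * A) = d *: D.
    rewrite scalerDl; apply: (lincomb (esym e)).
    by ncring.
  move=> /ind c2. have /eqP : c *+ 2 = 0 by rewrite mulr2n.
  by rewrite mulrn_eq0 => /eqP ->; rewrite scale0r.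
(* If [D * A] is a multiple of [D], then [D * (A + B)] is not; subtract the results for [A + B] and
   [B]. *)
move=> A; have [[k DA]|DA] := pselect (exists k, D * A = k *: D); last first.
  by apply: W => k DAk; apply: DA; exists k.
have : G (A + B) D = 0.
  apply: W => l DAB; apply: (DB (l - k)).
  by rewrite scalerBl -DAB mulrDr DA addrAC subrr add0r.
by rewrite defectDl (W B DB) addr0.
Qed.
End JordanDefect.

(** * The defect of a Jordan derivation of a nest algebra *)

Section LimitAtTop.
Variables (R : realType) (X : normedModType R[i]%C) (N : nest X).
Implicit Types (A B D : nest_alg N) (f : X -> R[i]%C) (E : set X).

Lemma proper_separation E : nest_set N E -> E <> setT ->
  exists f w, [/\ bounded_functional f, forall y, E y -> f y = 0 & f w = 1].
Proof.
move=> NE ET; have [w Ew] : exists w, ~ E w.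
  apply: contrapT => noW; apply: ET; apply/seteqP; split=> // w _.
  by apply: contrapT => Ew; apply: noW; exists w.
have [f [? ? ?]] := closed_subspace_separation
  (nest_closed (nestP N) NE) (nest_subspace (nestP N) NE) Ew.
by exists f, w.
Qed.

Lemma nest_element_separation E z : nest_set N E -> ~ E z ->
  exists f, [/\ bounded_functional f, forall y, E y -> f y = 0 & f z = 1].
Proof.
move=> NE; exact: closed_subspace_separation
  (nest_closed (nestP N) NE) (nest_subspace (nestP N) NE).
Qed.

(** By the chain property, an element of the nest either contains [E], hence [x], or lies in [E],
    where [f] vanishes. *)
Lemma rank_one_below E x f : nest_set N E -> E x -> bounded_functional f ->
  (forall y, E y -> f y = 0) -> exists D : nest_alg N, rank_one D x f.
Proof.
move=> NE Ex fb fE; apply: rank_one_exists => // F NF.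
have [EF|FE] := nest_chain (nestP N) NE NF; [left|right].
  exact: EF.
by move=> y /FE; exact: fE.
Qed.

Variable phi : {linear nest_alg N -> nest_alg N}.
Hypothesis phiJ : forall A, phi (A * A) = phi A * A + A * phi A.
Local Notation G := (defect phi).

(** The condition [M = X] in the form of an induction principle over closed subspaces. *)
Hypothesis proper_dense : forall P : set X, closed P -> linear_subspace P ->
  (forall E, nest_set N E -> E <> setT -> E `<=` P) -> P = setT.

Lemma proper_extension E : nest_set N E -> E <> setT ->
  exists E', [/\ nest_set N E', E' <> setT, E `<=` E' &
    exists z, E' z /\ ~ E z].
Proof.
move=> NE ET; apply: contrapT => noE'; apply: ET; apply: proper_dense.
- exact: (nest_closed (nestP N) NE).
- exact: (nest_subspace (nestP N) NE).
move=> E' NE' E'T z E'z; apply: contrapT => Ez; apply: noE'; exists E'.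
split=> //; last by exists z.
by have [//|E'E] := nest_chain (nestP N) NE NE'; case: Ez; exact: E'E.
Qed.

Lemma functional_proper_neq0 f w : bounded_functional f -> f w <> 0 ->
  exists E z, [/\ nest_set N E, E <> setT, E z & f z <> 0].
Proof.
move=> fb fw; apply: contrapT => noE; apply: fw.
suff : [set y | f y = 0] = setT by move/seteqP => [_ /(_ w I)].
apply: proper_dense.
- exact: closed_functional_kernel.
- split=> [|a x y /= fx fy]; first exact: functional0.
  by rewrite (functionalD fb) (functionalZ fb) fx fy mulr0 addr0.
move=> E NE ET z Ez; apply: contrapT => fz; apply: noE.
by exists E, z.
Qed.

(* For [D = x (x) f] with [f] vanishing on [E2], factor [D = P Q T] with
   [P = x (x) g'], [Q = z' (x) g] and [T = z (x) f] along [E < E1 < E2]. Then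
   [G (A, D) = G (A, P) Q T = - P Q G (T, A)] has range in the line of [x] and
   vanishes on the kernel of [f]. *)
Lemma defect_scalar E E2 x D A : nest_set N E -> nest_set N E2 ->
  (exists E1, [/\ nest_set N E1, E `<=` E1, E1 `<=` E2,
     exists z, E1 z /\ ~ E z & exists z, E2 z /\ ~ E1 z]) -> E x ->
  (exists f, [/\ bounded_functional f, forall y, E2 y -> f y = 0 &
     rank_one D x f]) ->
  exists c : R[i]%C, G A D = c *: D.
Proof.
move=> NE NE2 [E1 [NE1 EE1 E12 [z' [E1z' Ez']] [z [E2z E1z]]]] Ex.
move=> [h [hb hE2 Dxh]].
have [g' [g'b g'E g'z']] := nest_element_separation NE Ez'.
have [g [gb gE1 gz]] := nest_element_separation NE1 E1z.
have [P Px] := rank_one_below NE Ex g'b g'E.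
have [Q Qz'] := rank_one_below NE1 E1z' gb gE1.
have [T Tz] := rank_one_below NE2 E2z hb hE2.
have DE : D = P * Q * T.
  apply: nest_alg_ext => y; rewrite !nest_algM Dxh Tz Qz' Px.
  by rewrite (functionalZ gb) gz mulr1 (functionalZ g'b) g'z' mulr1.
have [|||GP GT] := defect_triple (@nest_alg_two_torsion_free _ _ N) phiJ
  (p := P) (q := Q) (r := T).
- move=> b; apply: nest_alg_ext => y; rewrite !nest_algM Px Qz' nest_alg_argZ.
  rewrite (functionalZ gb) (gE1 _ (EE1 _ (nest_alg_stable b NE Ex))).
  by rewrite mulr0 scale0r.
- move=> b; apply: nest_alg_ext => y; rewrite !nest_algM Px Tz nest_alg_argZ.
  rewrite (functionalZ hb) (hE2 _ (E12 _ (EE1 _ (nest_alg_stable b NE Ex)))).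
  by rewrite mulr0 scale0r.
- move=> b; apply: nest_alg_ext => y; rewrite !nest_algM Qz' Tz nest_alg_argZ.
  rewrite (functionalZ hb) (hE2 _ (E12 _ (nest_alg_stable b NE1 E1z'))).
  by rewrite mulr0 scale0r.
set u := G A P (Q z).
have Gu y : G A D y = h y *: u.
  by rewrite DE GP !nest_algM Tz !nest_alg_argZ.
have Gx y : exists m, G A D y = m *: x.
  rewrite (defect_anti phiJ) DE GT nest_algN !nest_algM Px.
  by eexists; rewrite -scaleNr.
have [[y0 /eqP hy0]|h0] := pselect (exists y, h y <> 0).
  have [m Gm] := Gx y0; exists ((h y0)^-1 * m).
  apply: nest_alg_ext => y; rewrite Gu nest_algZ Dxh.
  rewrite scalerA mulrC -scalerA; congr (_ *: _).
  by rewrite -scalerA -Gm Gu scalerA mulVf// scale1r.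
exists 0; apply: nest_alg_ext => y; rewrite Gu scale0r nest_alg0.
by have [->|/eqP hy] := eqVneq (h y) 0; [rewrite scale0r | case: h0; exists y].
Qed.

Lemma defect_eq0_limit A B : G A B = 0.
Proof.
apply: nest_alg_ext => v; rewrite nest_alg0.
suff : [set y | G A B y = 0] = setT by move/seteqP => [_ /(_ v I)].
have [Gcl Gsub] := nest_alg_kernel (G A B).
apply: proper_dense => //.
move=> E NE ET.
(* Two strict enlargements provide the chain along which [defect_scalar] factors. *)
have [E1 [NE1 E1T EE1 zE1]] := proper_extension NE ET.
have [E2 [NE2 E2T E12 zE2]] := proper_extension NE1 E1T.
have [f [w [fb fE2 fw]]] := proper_separation NE2 E2T.
have fE y : E y -> f y = 0 by move=> /EE1/E12/fE2.
have fw0 : f w <> 0 by rewrite fw; apply/eqP/oner_neq0.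
apply: (defect_annihilates phiJ (f := f)).
- by move=> C x; exact: nest_alg_stable.
- by exists w.
move=> x Ex {A B Gcl Gsub}; have [D Dx] := rank_one_below NE Ex fb fE.
exists D => // B; rewrite (defect_anti phiJ).
have [x0|/eqP x0] := eqVneq x 0.
  suff -> : D = 0 by rewrite defectr0 oppr0.
  by apply: nest_alg_ext => y; rewrite Dx x0 scaler0.
(* With [f z] nonzero and [h z = 0], the operator [C] sends [y] to [h y *: z]. Then [D * C] is no
   multiple [k *: D]: evaluation at [z] forces [k = 0], and evaluation at [t] refutes this. *)
have [E3 [z [NE3 E3T E3z fz]]] := functional_proper_neq0 fb fw0.
have [h [t [hb hE3 ht]]] := proper_separation NE3 E3T.
have [C Cz] := rank_one_below NE3 E3z hb hE3.
apply/eqP; rewrite oppr_eq0; apply/eqP.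
apply: (@scalar_defect_eq0 _ _ _ _ phiJ [set D | exists f,
  [/\ bounded_functional f, forall y, E2 y -> f y = 0 & rank_one D x f]]
  _ _ _ D C).
- move=> D1 D2 [f1 [f1b f10 D1x]] [f2 [f2b f20 D2x]].
  exists (fun y => f1 y + f2 y); split; first exact: bounded_functional_add.
    by move=> y E2y; rewrite f10// f20// addr0.
  exact: rank_one_add.
- move=> D1 B1 [f1 [f1b f10 D1x]]; exists (f1 \o B1); split.
  + exact: bounded_functional_comp.
  + by move=> y E2y /=; rewrite f10//; exact: nest_alg_stable.
  + exact: rank_one_mulr.
- move=> D1 B1 D1f; apply: (defect_scalar _ NE NE2 _ Ex D1f).
  by exists E1.
- by exists f.
move=> k DC.
have key y : h y * f z = k * f y.
  have := congr1 (fun S : nest_alg N => S y) DC.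
  rewrite nest_algM nest_algZ Cz !Dx (functionalZ fb) scalerA => /eqP.
  rewrite -subr_eq0 -scalerBl scaler_eq0 subr_eq0 => /orP[/eqP//|/eqP] //.
have := key z; rewrite hE3// mul0r => /esym/eqP; rewrite mulf_eq0.
move=> /orP[/eqP k0|/eqP//]; have := key t.
by rewrite ht mul1r k0 mul0r.
Qed.

End LimitAtTop.

Lemma mulf_add_self_eq0 (K : numFieldType) (a b : K) :
  a * b + a * b = 0 -> b != 0 -> a = 0.
Proof.
move=> /eqP; rewrite -mulr2n mulrn_eq0 /= mulf_eq0 => /orP[/eqP//|/eqP ->].
by rewrite eqxx.
Qed.

Lemma scaler_eq0_cancel (K : numFieldType) (V : lmodType K) (a : K) (x : V) :
  a *: x = 0 -> a <> 0 -> x = 0.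
Proof. by move=> /eqP; rewrite scaler_eq0 => /orP[/eqP//|/eqP]. Qed.

(** * The case of a largest proper element *)

Section GapAtTop.
Variables (R : realType) (X : normedModType R[i]%C) (N : nest X).
Implicit Types (A B D : nest_alg N) (f : X -> R[i]%C) (E : set X).
Variable phi : {linear nest_alg N -> nest_alg N}.
Hypothesis phiJ : forall A, phi (A * A) = phi A * A + A * phi A.
Local Notation G := (defect phi).
Local Notation torsion := (@nest_alg_two_torsion_free _ _ N).

Lemma defectZl c A B : G (c *: A) B = c *: G A B.
Proof.
rewrite /defect nest_alg_scalerAl !linearZ /= !nest_alg_scalerAl.
by rewrite !scalerBr.
Qed.

Variable M : set X.
Hypotheses (NM : nest_set N M) (MT : M <> setT).
Hypothesis Mtop : forall E, nest_set N E -> E = setT \/ E `<=` M.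

(** These are the functionals of [X / M]; they form rank-one operators of the algebra with arbitrary
    vectors. *)
Definition annihilates_top f : Prop :=
  bounded_functional f /\ forall y, M y -> f y = 0.

Local Notation annM := annihilates_top.

Lemma rank_one_top x f : annM f -> exists D : nest_alg N, rank_one D x f.
Proof.
move=> [fb fM]; apply: rank_one_exists => // E NE.
by have [->|EM] := Mtop NE; [left | right=> y /EM; exact: fM].
Qed.

(** Reduces to idempotent [D]: any [x] is [(x - k w) + k w] with [k = f x - 1], and [f] equals 1 at
    both [x - k w] and [w]. *)
Lemma defect_eq0_of_rank_one f w : annM f -> f w = 1 ->
    (forall x D, rank_one D x f -> f x = 1 -> ~ M x -> forall B, G D B = 0) ->
  forall A B, G A B = 0.
Proof.
move=> fM fw good A B.
have notM x : f x = 1 -> ~ M x.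
  by move=> fx /(fM.2 x); rewrite fx => /eqP; rewrite oner_eq0.
apply: nest_alg_ext => v; rewrite nest_alg0.
apply: (defect_annihilates phiJ (S := setT) (f := f)) => //.
  by exists w; rewrite fw; apply/eqP/oner_neq0.
move=> x _; have [D Dx] := rank_one_top x fM.
have [Dw Dww] := rank_one_top w fM.
have fb := fM.1.
pose k := f x - 1; have fx1 : f (x - k *: w) = 1.
  by rewrite (functionalB fb) (functionalZ fb) fw mulr1 /k opprB addrC subrK.
have [D1 D1x] := rank_one_top (x - k *: w) fM.
exists D => // C.
have -> : D = D1 + k *: Dw.
  apply: nest_alg_ext => y; rewrite nest_algD nest_algZ D1x Dww Dx.
  by rewrite scalerBr !scalerA [k * _]mulrC subrK.
rewrite defectDl defectZl (good _ _ Dww)//; last exact: notM.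
by rewrite (good _ _ D1x)// ?scaler0 ?addr0//; exact: notM.
Qed.

Lemma defect_eq0_hyperplane w0 :
    (forall y, exists c : R[i]%C, M (y - c *: w0)) ->
  forall A B, G A B = 0.
Proof.
move=> Mw0; have [f [w [fb fM fw]]] := proper_separation NM MT.
apply: (defect_eq0_of_rank_one (f := f) (w := w)) => // x D Dx fx _ B.
(* As [M] has codimension one, it is the whole kernel of [f]. So [1 - D] maps into [M], which [b]
   preserves and [f] kills. *)
have kerM y : f y = 0 -> M y.
  move=> fy; have [c Mc] := Mw0 y; have [c' Mc'] := Mw0 w.
  have := fM _ Mc'; have := fM _ Mc.
  rewrite !(functionalB fb) !(functionalZ fb) fy fw sub0r => /eqP.
  rewrite oppr_eq0 mulf_eq0 => /orP[/eqP c0|/eqP ->]; last first.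
    by move/eqP; rewrite mulr0 subr0 oner_eq0.
  by move: Mc; rewrite c0 scale0r subr0.
apply: (defect_corner_idempotent torsion phiJ).
  apply: nest_alg_ext => y.
  by rewrite nest_algM !Dx (functionalZ fb) fx mulr1.
move=> b; apply: nest_alg_ext => y; rewrite !nest_algM !Dx; congr (_ *: _).
apply/eqP; rewrite -subr_eq0 -(functionalB fb).
rewrite -nest_alg_argN -nest_alg_argD; apply/eqP/fM/(nest_alg_stable b NM).
by apply: kerM; rewrite (functionalB fb) (functionalZ fb) fx mulr1 subrr.
Qed.

Let K A B := A * B - B * A.

Lemma herstein_rank_one A B f x y : annM f ->
  f (K A B y) *: G A B x + f (G A B y) *: K A B x = 0.
Proof.
move=> fM; have [C Cx] := rank_one_top x fM.
have := congr1 (fun S : nest_alg N => S y)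
  (herstein_identity torsion phiJ A B C).
by rewrite nest_algD !nest_algM !Cx !nest_alg_argZ.
Qed.

(** If [f (G A B y)] is nonzero, the rank-one identity makes [K A B] a multiple [m] of [G A B]; the
    choice [x = y] then forces [m = 0]. *)
Lemma defect_into_top_of_noncommuting A B f y :
  annM f -> K A B <> 0 -> f (G A B y) = 0.
Proof.
move=> fM K0; apply: contrapT => /eqP fG; apply: K0.
have fb := fM.1.
have [m Km] : exists m : R[i]%C, forall x, K A B x = m *: G A B x.
  exists (- (f (K A B y) / f (G A B y))) => x.
  have /eqP := herstein_rank_one A B x y fM; rewrite addrC addr_eq0 => /eqP e.
  rewrite scaleNr mulrC -scalerA -scalerN -e scalerA mulVf//.
  by rewrite scale1r.
have := herstein_rank_one A B y y fM.
rewrite Km (functionalZ fb) scalerA [_ * m]mulrC -scalerDl => /eqP.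
rewrite scaler_eq0 => /orP[/eqP mf|/eqP Gy]; last first.
  by move: fG; rewrite Gy (functional0 fb) eqxx.
have m0 := mulf_add_self_eq0 mf fG.
by apply: nest_alg_ext => x; rewrite Km m0 scale0r.
Qed.

(** If [A] commutes with [B] but not with some [B'], use [B + B'] and [B']. If [A] commutes with
    everything, commuting with rank-one operators makes it scalar, and [G 1 B = 0]. *)
Lemma defect_into_top A B f y : annM f -> f (G A B y) = 0.
Proof.
move=> fM; have fb := fM.1.
have KD B' : K A (B + B') = K A B + K A B'.
  by rewrite /K; ncring.
have [[B' AB']|AC] := pselect (exists B', K A B' <> 0).
  have [AB|/eqP AB] := eqVneq (K A B) 0; last first.
    exact: defect_into_top_of_noncommuting.
  have := @defect_into_top_of_noncommuting A (B + B') f y fM.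
  rewrite KD AB add0r => /(_ AB'); rewrite defectDr nest_algD (functionalD fb).
  by rewrite (defect_into_top_of_noncommuting y fM AB') addr0.
have [h [w [hb hM hw]]] := proper_separation NM MT.
have -> : A = h (A w) *: (1 : nest_alg N).
  apply: nest_alg_ext => x; have [D Dx] := rank_one_top x (conj hb hM).
  have /subr0_eq/(congr1 (fun S : nest_alg N => S w)) : K A D = 0.
    by apply: contrapT => AD; apply: AC; exists D.
  by rewrite !nest_algM !Dx hw nest_alg_argZ scale1r.
rewrite defectZl (defect1l phiJ) scaler0.
exact: functional0.
Qed.

Lemma defect_eq0_noncommuting A B f y :
  annM f -> f (K A B y) <> 0 -> G A B = 0.
Proof.
move=> fM fK; apply: nest_alg_ext => x.
have := herstein_rank_one A B x y fM.
rewrite (defect_into_top _ _ _ fM) scale0r addr0 => /scaler_eq0_cancel.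
exact.
Qed.

Lemma defect_eq0_codim2 :
    (forall w, exists y, forall c : R[i]%C, ~ M (y - c *: w)) ->
  forall A B, G A B = 0.
Proof.
move=> M2; have [f [w [fb fM fw]]] := proper_separation NM MT.
have fannM : annM f by [].
apply: (defect_eq0_of_rank_one (f := f) (w := w)) => // x D Dx fx Mx B.
have KD B1 B' : K D (B1 + B') = K D B1 + K D B'.
  by rewrite /K; ncring.
(* [v] is no multiple of [x] modulo [M]. With [B'] sending [y] to [f y *: v], the commutator of [D]
   and [B'] maps [w] to [f v *: x - v], which lies outside [M]. *)
have [v Mv] := M2 x.
have [B' DB'w] := rank_one_top v fannM.
have [h [hb hM hK]] : exists h, [/\ bounded_functional h,
    forall y, M y -> h y = 0 & h (f v *: x - v) = 1].
  apply: nest_element_separation NM _ => Mfv; apply: (Mv (f v)).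
  have [_ Mlin] := nest_subspace (nestP N) NM.
  have := Mlin (-1) _ 0 Mfv (proj1 (nest_subspace (nestP N) NM)).
  by rewrite addr0 scaleN1r opprB.
have hK' : h (K D B' w) <> 0.
  rewrite /K nest_algB !nest_algM !Dx !DB'w fw !scale1r fx scale1r hK.
  by apply/eqP; exact: oner_neq0.
have GB' : G D B' = 0 by apply: (defect_eq0_noncommuting (y := w) (conj hb hM)).
(* If [h] does not detect the commutator with [B], it detects the one with [B + B']. *)
have [hB|hB] := pselect (h (K D B w) = 0); last first.
  exact: (defect_eq0_noncommuting (conj hb hM) hB).
have := @defect_eq0_noncommuting D (B + B') h w (conj hb hM).
rewrite KD nest_algD (functionalD hb) hB add0r => /(_ hK').
by rewrite defectDr GB' addr0.
Qed.

End GapAtTop.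

(** * From derivability at an invertible operator to vanishing defect *)

Section JordanDerivation.
Variables (R : realType) (X : completeNormedModType R[i]%C) (N : nest X).
Variable phi : {linear nest_alg N -> nest_alg N}.

Lemma derivable_at_jordan (Z : nest_alg N) : invertible_op Z ->
  derivable_at phi Z -> forall A, phi (A * A) = phi A * A + A * phi A.
Proof.
move=> [S [_ ZS]] der A.
have Zreg (B : nest_alg N) : B * Z = 0 -> B = 0.
  move=> BZ; apply: nest_alg_ext => v.
  have := congr1 (fun C : nest_alg N => C (S v)) BZ.
  rewrite nest_algM -[Z (S v)]/((nest_alg_op Z * S : bop X) v) ZS.
  by rewrite bop_oneE.
have [M1 M10 inv1] := add_scalar_invertible A.
have [M2 M20 inv2] := add_scalar_invertible (- A).
(* Large enough that [t] exceeds [M1], [t - 1] exceeds [M2] and both are positive, so [A + t] and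
   [1 - (A + t)] are both invertible. *)
pose t := M1 + M2 + 2.
have t0 : 0 < t by rewrite ltr_wpDl ?addr_ge0.
have t1E : t - 1 = M1 + M2 + 1 by rewrite /t -addrA; congr (_ + _); ring.
have t1 : 0 < t - 1 by rewrite t1E ltr_wpDl ?addr_ge0.
have [||a' [aa' a'a]] := inv1 t.
- by rewrite (ger0_norm (ltW t0)) /t -addrA lerDl addr_ge0.
- by rewrite gt_eqF.
have [||b' [bb' b'b]] := inv2 (1 - t).
- rewrite distrC (ger0_norm (ltW t1)) t1E -addrA addrCA lerDl.
  by rewrite addr_ge0.
- by rewrite subr_eq0 eq_sym -subr_eq0 gt_eqF.
have bE : 1 - (A + t *: (1 : nest_alg N)) = - A + (1 - t) *: (1 : nest_alg N).
  by rewrite scalerBl scale1r opprD addrCA.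
rewrite -bE in bb' b'b.
have tM B : t *: (1 : nest_alg N) * B = t *: B.
  by rewrite nest_alg_scalerAl mul1r.
apply: (jordan_shift (t := t *: (1 : nest_alg N))).
- by move=> B; rewrite tM nest_alg_scalerAr mulr1.
- by move=> B; rewrite !tM; exact: linearZ.
- exact: (phi1_of_derivable Zreg der).
- exact: (jordan_of_derivable Zreg der aa' a'a bb' b'b).
Qed.

Hypothesis phiJ : forall A, phi (A * A) = phi A * A + A * phi A.

Lemma jordan_defect_eq0 A B : defect phi A B = 0.
Proof.
pose proper := [set E | nest_set N E /\ E <> setT].
pose M := closed_span (\bigcup_(E in proper) E).
have NM : nest_set N M by apply: (nest_span (nestP N)) => E [].
have [MT|MT] := pselect (M = setT).
  apply: (defect_eq0_limit phiJ) => P Pcl Plin PE.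
  apply/seteqP; split=> // x _; have : M x by rewrite MT.
  rewrite (_ : P = closure P); last by apply/closure_id.
  apply: closureS; apply: smallest_sub => // y [E [NE ET] Ey].
  exact: (PE E).
have Mtop E : nest_set N E -> E = setT \/ E `<=` M.
  move=> NE; have [ET|ET] := pselect (E = setT); [by left | right].
  move=> x Ex; apply: subset_closure; by apply: sub_gen_smallest; exists E.
(* Whether [X / M] is spanned by a single vector. *)
have [[w0 Mw0]|M2] :=
    pselect (exists w0, forall y, exists c : R[i]%C, M (y - c *: w0)).
  exact: (defect_eq0_hyperplane phiJ NM MT Mtop Mw0).
apply: (defect_eq0_codim2 phiJ NM MT Mtop) => w; apply: contrapT => noy.
apply: M2; exists w => y; apply: contrapT => noc; apply: noy; exists y => c Mc.
by apply: noc; exists c.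
Qed.

End JordanDerivation.

Theorem corollary1p2 (R : realType) (X : completeNormedModType R[i]%C)
    (hX : dim_ge X 2) (N : nest X) (Z : nest_alg N) (hZ : invertible_op Z) :
  all_derivable_point Z.
Proof.
move=> phi der A B; have phiJ := derivable_at_jordan hZ der.
apply: (lincomb (jordan_defect_eq0 phiJ A B)).
by rewrite /defect; ncring.
Qed.
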